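(* Consider the Galois ring $\mathrm{GR}(p^2,r)$, where $p$ is an odd prime and $r$ a positive integer. Denote by $\mathcal{T}_S^*$ the set of Teichmüller squares and by $\mathcal{T}_N^*$ the set of Teichmüller non-squares. \begin{enumerate} \item If $p^r-1 \equiv 0 \pmod 4$, then $-1$ is a Teichmüller square, and $\mathcal{T}_S^* = -\mathcal{T}_S^*$ and $2\mathcal{T}_S^* \subseteq \Delta \mathcal{T}_S^*$. If $p^r-1 \equiv 2 \pmod 4$, then $-1$ is a Teichmüller non-square, and $\mathcal{T}_S^* = -\mathcal{T}_N^*$ and $2\mathcal{T}_S^* \subseteq \mathcal{T}_S^*-\mathcal{T}_N^*$. \item If $p^r-1 \equiv 0 \pmod{12}$, then $1 \in \Delta \mathcal{T}_S^*$, and $\mathcal{T}_S^* \subseteq \Delta \mathcal{T}_S^*$. If $p^r-1 \equiv 6 \pmod{12}$, then $1 \in \mathcal{T}_N^* - \mathcal{T}_S^*$, and $\mathcal{T}_S^* \subseteq \mathcal{T}_N^*-\mathcal{T}_S^*$. \item If $p^r-1 \equiv 0$ or $6 \pmod 8$, then $2$ is a square in $\mathrm{GR}(p^2,r)$, and $2\mathcal{T}_S^*$ is a square coset of $\mathcal{T}_S^*$. If $p^r-1 \equiv 2$ or $4 \pmod 8$, then $2$ is a non-square in $\mathrm{GR}(p^2,r)$, and $2\mathcal{T}_S^*$ is a non-square coset of $\mathcal{T}_S^*$. \end{enumerate}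
   Context: $\mathrm{GR}(p^2,r)$ is the Galois ring of characteristic $p^2$ and extension degree $r$, i.e. $\mathbb{Z}_{p^2}[x]/\langle f(x)\rangle$ with $f$ monic of degree $r$ whose reduction modulo $p$ is irreducible in $\mathbb{F}_p[x]$ (unique up to isomorphism, of order $p^{2r}$). Its Teichmüller group $\mathcal{T}^*=\{1,\xi,\dots,\xi^{p^r-2}\}$ is the cyclic subgroup of order $p^r-1$ of the unit group, with generator $\xi$; $\mathcal{T}=\mathcal{T}^*\cup\{0\}$; $\mathcal{T}_S^*=\{1,\xi^2,\dots,\xi^{p^r-3}\}$ and $\mathcal{T}_N^*=\{\xi,\xi^3,\dots,\xi^{p^r-2}\}$ are the Teichmüller squares and non-squares. A square coset of $\mathcal{T}_S^*$ is a set $(1+p\alpha)\mathcal{T}_S^*$ with $\alpha\in\mathcal{T}$; a non-square coset is a set $(1+p\alpha)\mathcal{T}_N^*=(1+p\alpha)\xi\mathcal{T}_S^*$ with $\alpha\in\mathcal{T}$. For subsets $A,B$ of the ring, $\Delta A=\{a-a' : a,a'\in A,\ a\ne a'\}$ and $A-B=\{a-b : a\in A, b\in B, a\ne b\}$ (multisets in general; in the membership and inclusion statements here they are regarded as sets). Also $-A=\{-a:a\in A\}$ and $2A=\{2a:a\in A\}$. *)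

(* Defs.v *)
From HB Require Import structures.
From mathcomp Require Import all_boot all_order all_algebra.

Set Implicit Arguments.
Unset Strict Implicit.
Unset Printing Implicit Defensive.

Import GRing.Theory.
Local Open Scope ring_scope.

(* Joins the finite type and commutative ring structures that qpoly.v declares
   separately on a quotient of polynomials over a finite ring. *)
HB.instance Definition _ (A : finComNzRingType) (h : {poly A}) :=
  Finite.on {poly %/ h}.

Definition Zp2_mod (p : nat) (c : 'Z_(p ^ 2)) : 'F_p := (val c)%:R.

(* Under this condition {poly %/ f} is the Galois ring GR(p^2, r): the quotient
   construction falls back to 'X only when f is not monic of size > 1. *)
Definition galois_ring_poly (p r : nat) (f : {poly 'Z_(p ^ 2)}) : Prop :=
  [/\ f \is monic, size f = r.+1 & irreducible_poly (map_poly (@Zp2_mod p) f)].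

Section Teichmuller.

Variables (R : finComNzRingType) (p r : nat).

(* A primitive root of unity of order p ^ r - 1 is exactly a generator of a
   cyclic subgroup of that order of the unit group. In GR(p^2, r), whose unit
   group has order (p ^ r - 1) * p ^ r, there is only one such subgroup. *)
Definition teich_generator (xi : R) : Prop := (p ^ r - 1).-primitive_root xi.

Variable xi : R.

Definition teich_group : {set R} := [set xi ^+ i | i : 'I_(p ^ r - 1)].

Definition teich_set : {set R} := 0 |: teich_group.

Definition teich_squares : {set R} :=
  [set xi ^+ i.*2 | i : 'I_((p ^ r - 1)./2)].

Definition teich_nonsquares : {set R} :=
  [set xi ^+ i.*2.+1 | i : 'I_((p ^ r - 1)./2)].

Definition square_coset (C : {set R}) : Prop :=
  exists2 a : R, a \in teich_set &
    C = [set (1 + p%:R * a) * t | t in teich_squares].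

Definition nonsquare_coset (C : {set R}) : Prop :=
  exists2 a : R, a \in teich_set &
    C = [set (1 + p%:R * a) * t | t in teich_nonsquares].

End Teichmuller.

Section SetOperations.

Variable R : finComNzRingType.

Definition diffs (A B : {set R}) : {set R} :=
  [set a - b | a in A, b in B & a != b].

Definition Delta (A : {set R}) : {set R} := diffs A A.

Definition opp_set (A : {set R}) : {set R} := [set - a | a in A].

Definition double_set (A : {set R}) : {set R} := [set 2%:R * a | a in A].

Definition ring_square (x : R) : Prop := exists y : R, x = y ^+ 2.

End SetOperations.

(* Main.v *)
Require Import Defs.
From HB Require Import structures.
From mathcomp Require Import all_boot all_order all_algebra.
From mathcomp Require Import ring zify.
Set Implicit Arguments.
Unset Strict Implicit.
Unset Printing Implicit Defensive.

Import GRing.Theory.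
Local Open Scope ring_scope.

(** Everything rests on three facts about R = GR(p^2, r), with q = p^r.

  Locality: an element of R is either a unit or a multiple of p. A polynomial
  that does not vanish modulo p is coprime to the irreducible reduction of f,
  and a Bezout relation over F_p, lifted to Z/p^2, makes it a unit up to a
  factor 1 + p c, which is invertible since p^2 = 0.

  Separation: distinct roots of X^(q-1) - 1 in R differ by a unit. Otherwise
  their quotient u is 1 modulo p, so u^p = 1, which together with u^(q-1) = 1
  forces u = 1. Hence an equation a * b = 0 in which a is a difference of two
  such roots can be solved as in a field: xi^((q-1)/2) = -1, and a primitive
  6-th root of unity z satisfies 1 = z - z^2. Parts 1 and 2 follow by looking
  at the parity of the exponents of xi, as 2 t = t - (- t).

  Teichmuller decomposition: (t, a) |-> t + p a is injective on pairs of
  elements of the Teichmuller set by separation, and it is onto because R has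
  q^2 elements. So a unit is uniquely (1 + p a) * xi^i. Applied to 2, this
  reduces part 3 to the parity of i, since 1 + p a is always a square. Raising
  to the power p (q-1)/2 kills 1 + p a and turns xi^i into (-1)^i, so that
  parity is read off from 2^((q-1)/2) modulo p, which is given by the second
  supplement to quadratic reciprocity. The latter is obtained by computing
  (z + z^-1)^q in a ring of characteristic p containing z with z^4 = -1. *)

(** * The second supplement to quadratic reciprocity *)

Lemma exp_mod8 (S : comNzRingType) (z : S) (k : nat) :
  z ^+ 4 = -1 -> z ^+ k = z ^+ (k %% 8)%N.
Proof.
move=> z4; rewrite {1}(divn_eq k 8) exprD mulnC exprM.
by rewrite (_ : z ^+ 8 = 1) ?expr1n ?mul1r // (exprM z 4 2) z4 sqrrN expr1n.
Qed.

(** The element t = z + z^-1 satisfies t^2 = 2, and the Frobenius gives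
    t^q = z^q + z^-q, which is t or - t according to q modulo 8. *)
Lemma second_supplement (S : comNzRingType) (z : S) (p q : nat) :
  p \in [pchar S] -> odd p -> p.-nat q -> z ^+ 4 = -1 ->
  2%:R ^+ q./2 = (-1) ^+ (q %% 8 \in [:: 3; 5])%N :> S.
Proof.
move=> pS p_odd q_p z4.
have q_odd : odd q.
  by have [k ->] := p_natP q_p; rewrite oddX p_odd orbT.
(* As z^4 = -1, the inverse of z is - z^3. *)
pose t := z - z ^+ 3.
have t2 : t ^+ 2 = 2%:R.
  have -> : t ^+ 2 = z ^+ 2 - z ^+ 4 *+ 2 + z ^+ 4 * z ^+ 2 by rewrite /t; ring.
  by rewrite z4; ring.
have tq : t ^+ q = (-1) ^+ (q %% 8 \in [:: 3; 5])%N * t.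
  have q_pS : [pchar S].-nat q by rewrite (eq_pnat _ (pcharf_eq pS)).
  rewrite exprDn_pchar // (exprNn (z ^+ 3)) -(signr_odd _ q) q_odd -exprM.
  rewrite (exp_mod8 q z4).
  rewrite (exp_mod8 (3 * q) z4) -modnMmr.
  have : (q %% 8 < 8)%N by rewrite ltn_mod.
  have : odd (q %% 8)%N by rewrite odd_mod.
  have z5 : z ^+ 5 = - z by rewrite (exprD z 4 1) z4 mulN1r.
  have z7 : z ^+ 7 = - z ^+ 3 by rewrite (exprD z 4 3) z4 mulN1r.
  move: (q %% 8)%N => -[|[|[|[|[|[|[|[|//]]]]]]]] //= _ _;
    rewrite ?z5 ?z7 /t ?expr1 ?expr0; ring.
have two_reg : forall x y : S, 2%:R * x = 2%:R * y -> x = y.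
  have p0 : p%:R = 0 :> S := pcharf0 pS.
  have e : - p./2%:R * 2%:R = 1 :> S.
    rewrite mulNr -natrM muln2; apply/eqP; rewrite eq_sym -addr_eq0 -p0.
    by rewrite -(natrD _ 1) -[1%N]/(true : nat) -p_odd odd_double_half.
  by move=> x y exy; rewrite -[x]mul1r -[y]mul1r -e -!mulrA exy.
(* Multiplied by 2, the left-hand side becomes 2^((q+1)/2) = t^(q+1). *)
apply: two_reg; rewrite -exprS -{1}t2 -exprM.
have -> : (2 * q./2.+1 = q + 1)%N by rewrite -{2}(odd_double_half q) q_odd; lia.
by rewrite exprD tq expr1 -mulrA -expr2 t2 mulrC.
Qed.

(** The second supplement compares images of integers, so it may be read in any
    ring of characteristic p; F_p[X] / (X^4 + 1) supplies the z it asks for. *)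
Lemma exists_sqrt_sqrt_opp1 (p : nat) : prime p ->
  exists (S : comNzRingType) (z : S), p \in [pchar S] /\ z ^+ 4 = -1.
Proof.
move=> p_prime; pose h : {poly 'F_p} := 'X^4 + 1.
have sz_h : size h = 5 by rewrite size_polyDl size_polyXn // size_poly1.
have h_mon : h \is monic.
  by rewrite monicE /lead_coef sz_h coefD coefXn coef1 addr0.
exists {poly %/ h}, (in_qpoly h 'X); split.
  by rewrite pchar_qpoly; exact: pchar_Fp.
apply/eqP; rewrite -addr_eq0 -rmorphXn -[X in _ + X](rmorph1 (in_qpoly h)).
rewrite -rmorphD; apply/eqP/val_inj => /=.
rewrite /mk_monic sz_h h_mon /=.
by rewrite -/h Pdiv.RingMonic.rmodpp.
Qed.

(** * Teichmuller elements of a finite local ring *)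

Lemma mod8_pred m : ~~ odd m ->
  (m.+1 %% 8 \in [:: 3; 5])%N = (m %% 8 \in [:: 2; 4])%N.
Proof. rewrite !inE; lia. Qed.

(** The hypotheses on R are all that is used about the Galois ring: p^2 = 0 but
    p <> 0, the elements are units or multiples of p, and the cardinality leaves
    room for exactly one element per pair of Teichmuller representatives. *)
Section TeichmullerClasses.

Variables (R : finComNzRingType) (p r : nat) (xi : R).
Hypotheses (p_prime : prime p) (p_odd : odd p) (r_gt0 : (0 < r)%N).
Hypotheses (p_neq0 : p%:R != 0 :> R) (p_sqr0 : p%:R ^+ 2 = 0 :> R).
Hypothesis unit_or_p : forall x : R,
  (exists y, y * x = 1) \/ (exists y, x = p%:R * y).
Hypothesis card_R : #|R| = ((p ^ r) ^ 2)%N.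
Hypothesis xi_gen : teich_generator p r xi.

Local Notation n := (p ^ r - 1)%N.
Local Notation TS := (teich_squares p r xi).
Local Notation TN := (teich_nonsquares p r xi).

(** The Boolean is the parity of the exponents of xi, so that the squares and
    the non-squares multiply like Booleans under exclusive or. *)
Definition teich_class (b : bool) : {set R} := if b then TN else TS.

Lemma card_residue : (p ^ r = n.+1)%N.
Proof. by rewrite subn1 prednK // expn_gt0 prime_gt0. Qed.

Lemma odd_n : odd n = false.
Proof.
by apply/negbTE; rewrite -[~~ _]/(odd n.+1) -card_residue oddX p_odd orbT.
Qed.

Lemma half_n : (n./2.*2 = n)%N.
Proof. by rewrite -[RHS]odd_double_half odd_n. Qed.

Lemma n_gt0 : (0 < n)%N. Proof. exact: prim_order_gt0 xi_gen. Qed.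

Lemma xi_expn : xi ^+ n = 1. Proof. exact: prim_expr_order xi_gen. Qed.

Lemma teich_classP b x :
  reflect (exists2 i : nat, odd i = b & x = xi ^+ i) (x \in teich_class b).
Proof.
have lt_half k : ((k %% n)./2 < n./2)%N.
  by rewrite ltn_half_double half_n ltn_mod n_gt0.
apply: (iffP idP) => [|[i odd_i ->]]; first case: b => /imsetP[i _ ->].
- by exists i.*2.+1; rewrite //= odd_double.
- by exists i.*2; rewrite ?odd_double.
have odd_im : odd (i %% n) = b by rewrite odd_mod ?odd_n.
rewrite -(prim_expr_mod xi_gen) -(odd_double_half (i %% n)) odd_im.
by rewrite /teich_class; case: b {odd_im odd_i};
  apply/imsetP; exists (Ordinal (lt_half i)).
Qed.

Lemma teich_class_xi i : xi ^+ i \in teich_class (odd i).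
Proof. by apply/teich_classP; exists i. Qed.

Lemma teich_classM b c x y :
  x \in teich_class b -> y \in teich_class c -> x * y \in teich_class (b (+) c).
Proof.
move=> /teich_classP[i <- ->] /teich_classP[j <- ->].
by rewrite -exprD -oddD teich_class_xi.
Qed.

Lemma teich_class_inv b x :
  x \in teich_class b -> exists2 y, y \in teich_class b & y * x = 1.
Proof.
move=> /teich_classP[i <- ->]; exists (xi ^+ (i * n.-1)).
  have -> : odd i = odd (i * n.-1); last exact: teich_class_xi.
  by rewrite oddM -[odd n.-1]negbK -oddS prednK ?n_gt0 // odd_n andbT.
by rewrite -exprD -mulnSr prednK ?n_gt0 // mulnC exprM xi_expn expr1n.
Qed.

Lemma teich_classX x b : x \in teich_class b -> x ^+ n = 1.
Proof. by move=> /teich_classP[i _ ->]; rewrite exprAC xi_expn expr1n. Qed.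

Lemma exp_one_add (z : R) k : z ^+ 2 = 0 -> (1 + z) ^+ k = 1 + z *+ k.
Proof.
move=> z2; elim: k => [|k IHk]; first by rewrite expr0 addr0.
rewrite exprS IHk mulrDl mul1r mulrDr mulr1 mulrnAr -expr2 z2.
by rewrite mul0rn addr0 mulrSr addrA.
Qed.

Lemma p_mul_sqr0 (y : R) : (p%:R * y) ^+ 2 = 0.
Proof. by rewrite exprMn p_sqr0 mul0r. Qed.

Lemma one_add_pX (y : R) : (1 + p%:R * y) ^+ p = 1.
Proof.
rewrite exp_one_add ?p_mul_sqr0 // -(mulr_natl (p%:R * y)) mulrA -expr2 p_sqr0.
by rewrite mul0r addr0.
Qed.

Lemma p_mul_nonunit (u y : R) : u * (p%:R * y) != 1.
Proof.
apply/eqP => e; have /eqP := p_mul_sqr0 y; apply/negP.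
have /eqP: (u * (p%:R * y)) ^+ 2 = 1 by rewrite e expr1n.
by rewrite exprMn p_mul_sqr0 mulr0 eq_sym (negbTE (oner_neq0 _)).
Qed.

(** The quotient u of x by y is 1 modulo p, so u^p = 1; since also u^n = 1
    with n.+1 a power of p, it is trivial. *)
Lemma teich_sep (x y z : R) :
  x ^+ n = 1 -> y ^+ n = 1 -> x - y = p%:R * z -> x = y.
Proof.
move=> xn yn xyz; pose v := y ^+ n.-1.
have vy : v * y = 1 by rewrite -exprSr prednK ?n_gt0.
have u1 : v * x = 1.
  have up : (v * x) ^+ p = 1.
    rewrite -(one_add_pX (v * z)); congr (_ ^+ _).
    by rewrite mulrCA -xyz mulrBr vy addrC subrK.
  have un : (v * x) ^+ n = 1.
    by rewrite exprMn -exprM mulnC exprM yn xn expr1n mul1r.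
  have : (v * x) ^+ (p ^ r) = 1.
    by rewrite -(prednK r_gt0) expnS exprM up expr1n.
  by rewrite card_residue exprSr un mul1r.
by rewrite -[x]mul1r -vy mulrAC u1 mul1r.
Qed.

Lemma teich_sub_unit (x y : R) :
  x ^+ n = 1 -> y ^+ n = 1 -> x != y -> exists u, u * (x - y) = 1.
Proof.
move=> xn yn; have [//|[z xyz]] := unit_or_p (x - y).
by rewrite (teich_sep xn yn xyz) eqxx.
Qed.

(** p^2 = 0 is odd, hence 2 k = -1 for k = (p^2 - 1) / 2. *)
Lemma two_unit : exists u, u * 2%:R = 1 :> R.
Proof.
have e : ((p ^ 2)%N = 1 + (p ^ 2)./2 * 2)%N.
  by rewrite muln2 -{1}(odd_double_half (p ^ 2)) oddX p_odd.
exists (- (p ^ 2)./2%:R); rewrite mulNr -natrM; apply/eqP.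
by rewrite eq_sym -addr_eq0 -(natrD _ 1) -e natrX p_sqr0.
Qed.

Lemma one_neq_opp1 : 1 != -1 :> R.
Proof.
have [u u2] := two_unit; apply/eqP => e.
have /eqP := u2; rewrite [2%:R](_ : _ = 1 + 1) // {2}e subrr mulr0.
by rewrite eq_sym (negbTE (oner_neq0 _)).
Qed.

(** A square root of 1 other than 1 is -1 because xi^(n/2) - 1 is a unit. *)
Lemma xi_half : xi ^+ n./2 = -1.
Proof.
have h2 : (xi ^+ n./2) ^+ 2 = 1 by rewrite -exprM muln2 half_n xi_expn.
have hn1 : xi ^+ n./2 != 1.
  rewrite -(prim_order_dvd xi_gen) gtnNdvd //.
    by rewrite half_gt0; move: n_gt0 odd_n; case: n => [|[]].
  by rewrite ltn_half_double -addnn -[ltnLHS]addn0 ltn_add2l n_gt0.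
have [||u /= hu] := teich_sub_unit _ _ hn1.
- by rewrite exprAC xi_expn expr1n.
- by rewrite expr1n.
apply/eqP; rewrite -addr_eq0 -[_ + 1]mul1r -{1}hu -mulrA -subr_sqr_1 h2 subrr.
by rewrite mulr0.
Qed.

(** * The opposite and the differences of Teichmuller squares *)

Lemma opp1_class : -1 \in teich_class (odd n./2).
Proof. by rewrite -xi_half teich_class_xi. Qed.

Lemma opp_class b x :
  x \in teich_class b -> - x \in teich_class (odd n./2 (+) b).
Proof. by rewrite -mulN1r; apply: teich_classM opp1_class. Qed.

Lemma squares_opp : TS = opp_set (teich_class (odd n./2)).
Proof.
apply/setP => x; apply/idP/imsetP => [xS|[y yc ->]].
  exists (- x); last by rewrite opprK.
  by rewrite -[odd _]addbF; apply: opp_class.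
by have := opp_class yc; rewrite addbb.
Qed.

(** 2 t = t - (- t). *)
Lemma double_squares_diffs :
  double_set TS \subset diffs TS (teich_class (odd n./2)).
Proof.
apply/subsetP => _ /imsetP[t tS ->]; apply/imset2P.
exists t (- t); last by rewrite opprK mulr_natl mulr2n.
  exact: tS.
rewrite inE -{1}[odd _]addbF opp_class //=; apply/eqP => tNt.
have [u _ ut] := teich_class_inv (tS : t \in teich_class false).
by case/eqP: one_neq_opp1; rewrite -ut {1}tNt mulrN.
Qed.

(** A primitive 6-th root of unity z = xi^k has z^3 = -1, so it is a root of
    X^2 - X + 1 = (X^3 + 1) / (X + 1), that is, 1 = z - z^2. *)
Lemma one_diffs k : (n = 6 * k)%N -> 1 \in diffs (teich_class (odd k)) TS.
Proof.
move=> nk; have k_gt0 : (0 < k)%N by move: n_gt0; rewrite nk muln_gt0.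
pose z := xi ^+ k; have zc : z \in teich_class (odd k) := teich_class_xi k.
have z3 : z ^+ 3 = -1 by rewrite -exprM -xi_half nk; congr (_ ^+ _); lia.
have z2n : z ^+ 2 != 1.
  rewrite -exprM -(prim_order_dvd xi_gen) gtnNdvd ?muln_gt0 ?k_gt0 //.
  by rewrite nk; lia.
have [||u /= zu] := teich_sub_unit _ _ z2n.
- by rewrite -exprM mulnC exprM (teich_classX zc) expr1n.
- by rewrite expr1n.
have z1 : z - z ^+ 2 = 1.
  (* The unit at hand is z^2 - 1, whence the extra factor z - 1. *)
  have e : (z ^+ 2 - 1) * (z - z ^+ 2 - 1) = 0.
    have -> : (z ^+ 2 - 1) * (z - z ^+ 2 - 1) = (z ^+ 3 + 1) * (1 - z) by ring.
    by rewrite z3 addNr mul0r.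
  by apply/eqP; rewrite -subr_eq0 -[_ - 1]mul1r -{1}zu -mulrA e mulr0.
apply/imset2P; exists z (z ^+ 2) => //.
rewrite inE -[TS]/(teich_class false) -(addbb (odd k)) expr2 teich_classM //=.
by rewrite -expr2 -subr_eq0 z1 oner_neq0.
Qed.

Lemma squares_diffs b :
  1 \in diffs (teich_class b) TS -> TS \subset diffs (teich_class b) TS.
Proof.
move=> /imset2P[x y xc]; rewrite inE => /andP[yS xy] e1.
apply/subsetP => t tS; apply/imset2P; exists (x * t) (y * t).
- by rewrite -(addbF b) teich_classM.
- rewrite inE -[TS]/(teich_class (false (+) false)) teich_classM //=.
  rewrite -subr_eq0 -mulrBl -e1 mul1r; apply/eqP => t0.
  have [u _ /eqP] := teich_class_inv (tS : t \in teich_class false).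
  by rewrite t0 mulr0 eq_sym (negbTE (oner_neq0 _)).
- by rewrite -mulrBl -e1 mul1r.
Qed.

(** * The Teichmuller decomposition *)

Lemma teich_setP x :
  reflect (x = 0 \/ exists i : nat, x = xi ^+ i) (x \in teich_set p r xi).
Proof.
apply: (iffP setU1P) => [] [->|]; try by left.
  by case/imsetP=> i _ ->; right; exists i.
case=> i ->; right; rewrite -(prim_expr_mod xi_gen).
have lt_in : (i %% n < n)%N by rewrite ltn_mod n_gt0.
by apply/imsetP; exists (Ordinal lt_in).
Qed.

Lemma teich_set_sep x y z : x \in teich_set p r xi -> y \in teich_set p r xi ->
  x - y = p%:R * z -> x = y.
Proof.
have xi_neq i : exists u, u * xi ^+ i = 1.
  by have [u _ ui] := teich_class_inv (teich_class_xi i); exists u.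
have xin i : (xi ^+ i) ^+ n = 1 by exact: teich_classX (teich_class_xi i).
move=> /teich_setP[->|[i ->]] /teich_setP[->|[j ->]] e //.
- have [u uj] := xi_neq j; case/eqP: (p_mul_nonunit (- u) z).
  by rewrite -e sub0r mulrNN.
- have [u uj] := xi_neq i; case/eqP: (p_mul_nonunit u z).
  by rewrite -e subr0.
by apply: teich_sep e.
Qed.

Lemma card_teich_set : #|teich_set p r xi| = (p ^ r)%N.
Proof.
rewrite cardsU1 card_imset ?card_ord => [|i j /eqP].
  have -> : 0 \notin teich_group p r xi; last by rewrite add1n -card_residue.
  apply/imsetP => -[i _ /eqP]; rewrite eq_sym => /eqP i0.
  have [u _] := teich_class_inv (teich_class_xi i).
  by rewrite i0 mulr0 => /eqP; rewrite eq_sym (negbTE (oner_neq0 _)).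
by rewrite (eq_prim_root_expr xi_gen) !modn_small // => /eqP/val_inj.
Qed.

(** Injectivity comes from separation, first modulo p for t, then after
    division by p for a; surjectivity is a matter of cardinality. *)
Lemma teich_decomp (x : R) :
  exists t a, [/\ t \in teich_set p r xi, a \in teich_set p r xi
                & x = t + p%:R * a].
Proof.
pose T := teich_set p r xi; pose g (u : R * R) := u.1 + p%:R * u.2.
have g_inj : {in setX T T &, injective g}.
  move=> [t a] [t' a'] /setXP[/= tT aT] /setXP[/= tT' aT'] e.
  rewrite /g /= in e.
  have tt : t = t'.
    apply: (teich_set_sep (z := a' - a)) => //.
    by rewrite mulrBr -[t](addrK (p%:R * a)) e; ring.
  congr (_, _) => //; have paa : p%:R * (a - a') = 0.
    by rewrite mulrBr; apply/eqP; rewrite subr_eq0 -(inj_eq (addrI t)) e tt.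
  have [[y ya]|[z]] := unit_or_p (a - a'); last exact: teich_set_sep.
  by case/eqP: p_neq0; rewrite -(mulr0 y) -paa mulrCA ya mulr1.
have : x \in g @: setX T T.
  have -> : g @: setX T T = setT; last by rewrite inE.
  apply/eqP; rewrite eqEcard subsetT cardsT card_R card_in_imset //.
  by rewrite cardsX card_teich_set mulnn leqnn.
by case/imsetP=> -[t a] /setXP[/= tT aT] ->; exists t, a.
Qed.

Lemma unit_decomp (x y : R) : y * x = 1 -> exists i a,
  a \in teich_set p r xi /\ x = (1 + p%:R * a) * xi ^+ i.
Proof.
move=> yx; have [t [a [/teich_setP[t0|[i ti]] aT xta]]] := teich_decomp x.
  case/eqP: (p_mul_nonunit y a); by rewrite -[RHS]yx xta t0 add0r.
have [u uc uxi] := teich_class_inv (teich_class_xi i).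
exists i, (a * u); split.
  have /teich_classP[j _ ->] := uc; apply/teich_setP.
  case/teich_setP: aT => [->|[k ->]]; first by left; rewrite mul0r.
  by right; exists (k + j)%N; rewrite exprD.
by rewrite mulrDl mul1r -!mulrA uxi mulr1 -ti.
Qed.

Lemma unit_expn (x y : R) : y * x = 1 -> x ^+ (n * p) = 1.
Proof.
move=> /unit_decomp[i [a [_ ->]]]; rewrite exprMn (exprM (xi ^+ i)).
rewrite (teich_classX (teich_class_xi i)) expr1n mulr1 mulnC exprM one_add_pX.
by rewrite expr1n.
Qed.

(** * Quadratic character of 2 *)

(** The subgroup 1 + p R has odd exponent p, so u = (u^((p+1)/2))^2 there. *)
Lemma one_add_p_square (a : R) : ring_square (1 + p%:R * a).
Proof.
exists ((1 + p%:R * a) ^+ p.+1./2); rewrite -exprM muln2 halfK oddS p_odd.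
by rewrite subn0 exprS one_add_pX mulr1.
Qed.

Lemma sign_eq (b c : bool) : (-1) ^+ b = (-1) ^+ c :> R -> b = c.
Proof.
case: b c => [] [] // e; have /eqP[] := one_neq_opp1; first exact: esym e.
exact: e.
Qed.

(** The second supplement gives 2^(n/2) modulo p only; the p-th power removes
    the unknown factor 1 + p c. The residues 3 and 5 of p^r modulo 8 become 2
    and 4 for n = p^r - 1. *)
Lemma two_expn : 2%:R ^+ (n./2 * p) = (-1) ^+ (n %% 8 \in [:: 2; 4])%N :> R.
Proof.
set b : bool := _ \in _.
have [S [z [pS z4]]] := exists_sqrt_sqrt_opp1 p_prime.
have p_pow : p.-nat (p ^ r)%N by rewrite pnatX pnat_id.
have e2 := second_supplement pS p_odd p_pow z4.
rewrite card_residue mod8_pred ?odd_n // -/b /= uphalf_half odd_n add0n in e2.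
move: n./2 e2 => m e2.
have [k e] : exists k, (2 ^ m + (if b then 1 else p.-1) = p * k)%N.
  have /dvdnP[k ->] : (p %| 2 ^ m + (if b then 1 else p.-1))%N; last first.
    by exists k; rewrite mulnC.
  rewrite (dvdn_pcharf pS) natrD natrX e2; case: b {e2}; first by rewrite addNr.
  by rewrite -[_ ^+ _]/(1%:R) -natrD add1n prednK ?prime_gt0 // pcharf0.
rewrite exprM.
have [c ->] : exists c, 2%:R ^+ m = (-1) ^+ b * (1 + p%:R * c) :> R.
  move/(congr1 (fun i => i%:R : R)): e; rewrite natrD natrX natrM.
  case: b {e2} => e.
    by exists (- k%:R); rewrite -[LHS](addrK 1) e expr1; ring.
  exists (k%:R - 1); move: e; rewrite -subn1 natrB ?prime_gt0 // => e.
  by rewrite -[LHS](addrK (p%:R - 1)) e; ring.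
by rewrite exprMn one_add_pX mulr1 -exprM mulnC exprM -(signr_odd _ p) p_odd.
Qed.

(** The parity of i is found by raising both sides to the power p * n / 2. *)
Lemma two_decomp : exists i a, [/\ a \in teich_set p r xi,
  2%:R = (1 + p%:R * a) * xi ^+ i & odd i = (n %% 8 \in [:: 2; 4])%N].
Proof.
have [u /unit_decomp[i [a [aT e2]]]] := two_unit.
exists i, a; split => //; apply: sign_eq; rewrite -two_expn e2 exprMn.
rewrite mulnC exprM one_add_pX expr1n mul1r exprAC mulnC exprM xi_half.
by rewrite -(signr_odd _ p) p_odd expr1 signr_odd.
Qed.

Lemma double_squares_coset : exists2 a, a \in teich_set p r xi &
  double_set TS =
    [set (1 + p%:R * a) * t | t in teich_class (n %% 8 \in [:: 2; 4])%N].
Proof.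
have [i [a [aT e2 <-]]] := two_decomp; exists a => //.
apply/setP => x; apply/imsetP/imsetP => -[t tc ->].
  exists (xi ^+ i * t); last by rewrite e2 mulrA.
  by rewrite -(addbF (odd i)) teich_classM // teich_class_xi.
have [u uc ux] := teich_class_inv (teich_class_xi i).
exists (u * t); last first.
  by rewrite e2 -mulrA [xi ^+ i * _]mulrA [xi ^+ i * u]mulrC ux mul1r.
by rewrite -[TS]/(teich_class false) -(addbb (odd i)) teich_classM.
Qed.

(** Squares of units are killed by the exponent p * n / 2, while 2 is sent to
    -1 in the excluded residue classes. *)
Lemma two_square_iff :
  ring_square (2%:R : R) <-> (n %% 8 \notin [:: 2; 4])%N.
Proof.
have [i [a [aT e2 odd_i]]] := two_decomp.
split=> [[y y2]|]; last first.
  rewrite -odd_i => /negbTE even_i; have [y ey] := one_add_p_square a.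
  exists (y * xi ^+ i./2); rewrite exprMn -ey -exprM muln2.
  by rewrite -{1}(odd_double_half i) even_i in e2.
have [u uy] := two_unit; have yX : y ^+ (n * p) = 1.
  by apply: (@unit_expn _ (u * y)); rewrite -mulrA -expr2 -y2.
have := two_expn; rewrite y2 -exprM mulnA mul2n half_n yX.
by case: (_ \in _) => // /eqP; rewrite expr1 (negbTE one_neq_opp1).
Qed.

Lemma teich_squares_cosets_and_differences :
  [/\ (n = 0 %[mod 4] ->
         [/\ -1 \in TS, TS = opp_set TS & double_set TS \subset Delta TS])
      /\ (n = 2 %[mod 4] ->
         [/\ -1 \in TN, TS = opp_set TN & double_set TS \subset diffs TS TN]),
      (n = 0 %[mod 12] ->
         1 \in Delta TS /\ TS \subset Delta TS)
      /\ (n = 6 %[mod 12] ->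
         1 \in diffs TN TS /\ TS \subset diffs TN TS)
    & (n = 0 %[mod 8] \/ n = 6 %[mod 8] ->
         ring_square (2%:R : R)
         /\ square_coset p r xi (double_set TS))
      /\ (n = 2 %[mod 8] \/ n = 4 %[mod 8] ->
         ~ ring_square (2%:R : R)
         /\ nonsquare_coset p r xi (double_set TS))].
Proof.
split; split=> nmod.
- have h : odd n./2 = false by lia.
  have := (opp1_class, squares_opp, double_squares_diffs); rewrite h.
  by case=> [[]].
- have h : odd n./2 = true by lia.
  have := (opp1_class, squares_opp, double_squares_diffs); rewrite h.
  by case=> [[]].
- have [k nk odd_k] : exists2 k, (n = 6 * k)%N & odd k = false.
    by exists (n %/ 6)%N; lia.
  have h1 : 1 \in diffs (teich_class false) TS by rewrite -odd_k one_diffs.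
  by split; [exact: h1 | exact: squares_diffs h1].
- have [k nk odd_k] : exists2 k, (n = 6 * k)%N & odd k = true.
    by exists (n %/ 6)%N; lia.
  have h1 : 1 \in diffs (teich_class true) TS by rewrite -odd_k one_diffs.
  by split; [exact: h1 | exact: squares_diffs h1].
- have h : (n %% 8 \in [:: 2; 4])%N = false by case: nmod => ->.
  split; first by apply/two_square_iff; rewrite h.
  by have := double_squares_coset; rewrite h.
- have h : (n %% 8 \in [:: 2; 4])%N = true by case: nmod => ->.
  have := double_squares_coset; rewrite h; split => //.
  by move/two_square_iff; rewrite h.
Qed.

End TeichmullerClasses.

(** * The Galois ring is local of order p^(2r) *)

Lemma p_sqr_gt1 (p : nat) : prime p -> (1 < p ^ 2)%N.
Proof. by move=> p_prime; rewrite (ltn_exp2l 0) ?prime_gt1. Qed.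

Lemma Zp2_mod_nat (p k : nat) : prime p -> Zp2_mod (k%:R : 'Z_(p ^ 2)) = k%:R.
Proof.
move=> p_prime; have p2_gt1 := p_sqr_gt1 p_prime.
have e m : (m %% p)%:R = m%:R :> 'F_p.
  by apply: ord_inj; rewrite !val_Fp_nat // modn_mod.
rewrite /Zp2_mod -[val _]/(nat_of_ord _) val_Zp_nat // -e modn_dvdm ?e //.
by rewrite expnS dvdn_mulr.
Qed.

Lemma natr_qpoly_eq0 (m k : nat) (h : {poly 'Z_m}) :
  (1 < m)%N -> (k%:R == 0 :> {poly %/ h}) = (m %| k)%N.
Proof.
move=> m_gt1; rewrite -val_eqE [val _]qpolyC_natr -polyC_natr polyC_eq0.
by rewrite -val_eqE [X in X == _](val_Zp_nat m_gt1).
Qed.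

Section GaloisRing.

Variables (p r : nat) (f : {poly 'Z_(p ^ 2)}).
Hypotheses (p_prime : prime p) (r_gt0 : (0 < r)%N).
Hypothesis f_gal : galois_ring_poly r f.

Local Notation A := 'Z_(p ^ 2).
Local Notation R := {poly %/ f}.

Lemma Zp2_mod_is_zmod_morphism : zmod_morphism (@Zp2_mod p).
Proof.
(* The natural number p^2 - b represents - b. *)
move=> a b; have -> : a - b = (a + (p ^ 2 - b))%:R.
  rewrite natrD natrB; last first.
    by rewrite -[leqRHS](Zp_cast (p_sqr_gt1 p_prime)) ltnW.
  by rewrite pchar_Zp ?p_sqr_gt1 // sub0r !natr_Zp.
rewrite Zp2_mod_nat // natrD natrB; last first.
  by rewrite -[leqRHS](Zp_cast (p_sqr_gt1 p_prime)) ltnW.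
by rewrite natrX pchar_Fp_0 // expr0n sub0r.
Qed.

Lemma Zp2_mod_is_monoid_morphism : monoid_morphism (@Zp2_mod p).
Proof.
split=> [|a b]; first exact: (Zp2_mod_nat 1).
by rewrite -[a in LHS]natr_Zp -[b in LHS]natr_Zp -natrM Zp2_mod_nat // natrM.
Qed.

HB.instance Definition _ :=
  GRing.isZmodMorphism.Build A 'F_p (@Zp2_mod p) Zp2_mod_is_zmod_morphism.
HB.instance Definition _ :=
  GRing.isMonoidMorphism.Build A 'F_p (@Zp2_mod p) Zp2_mod_is_monoid_morphism.

Local Notation red := (map_poly (@Zp2_mod p)).

Lemma red_surj (g : {poly 'F_p}) : exists h : {poly A}, red h = g.
Proof.
exists (map_poly (fun c : 'F_p => (val c)%:R) g); apply/polyP=> i.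
by rewrite coef_map coef_map_id0 //= Zp2_mod_nat // natr_Zp.
Qed.

Lemma red_eq0 (h : {poly A}) : red h = 0 -> exists g, h = p%:R * g.
Proof.
move=> h0; exists (\poly_(i < size h) ((h`_i)%R %/ p)%N%:R); apply/polyP=> i.
rewrite -polyC_natr coefCM coef_poly; case: ltnP => [_|hi]; last first.
  by rewrite nth_default // mulr0.
have : (red h)`_i = 0 by rewrite h0 coef0.
rewrite coef_map /= /Zp2_mod => /(congr1 val) /=.
rewrite -[LHS]/(nat_of_ord _) val_Fp_nat // => /eqP /dvdnP[k e].
have {}e : nat_of_ord (h`_i) = (k * p)%N := e.
by rewrite -natrM -[LHS]natr_Zp e mulnK ?prime_gt0 // mulnC.
Qed.

Lemma mk_monic_f : mk_monic f = f.
Proof. by case: f_gal => f_mon sz _; rewrite /mk_monic sz f_mon ltnS r_gt0. Qed.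

Lemma in_qpoly_modulus : in_qpoly f f = 0.
Proof.
apply/val_inj; rewrite /= mk_monic_f Pdiv.RingMonic.rmodpp //.
by case: f_gal.
Qed.

Lemma in_qpoly_val (x : R) : in_qpoly f x = x.
Proof. by apply/val_inj/in_qpoly_small/size_mk_monic. Qed.

(** If x is nonzero modulo p, a Bezout relation between the reductions of x and
    f lifts to u x = 1 + p g in the quotient, and 1 - p g inverts 1 + p g. *)
Lemma galois_ring_local (x : R) :
  (exists y, y * x = 1) \/ (exists y, x = p%:R * y).
Proof.
have [f_mon sz f_irr] := f_gal.
have [x0|x_neq0] := eqVneq (red x) 0.
  right; have [g xg] := red_eq0 x0; exists (in_qpoly f g).
  by rewrite -[LHS]in_qpoly_val xg rmorphM rmorph_nat.
have x_small : (size (red x) < size (red f))%N.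
  rewrite [ltnRHS]size_map_poly_id0 ?(monicP f_mon) ?rmorph1 ?oner_neq0 //.
  by rewrite (leq_ltn_trans (size_poly _ _)) // -{2}mk_monic_f size_mk_monic.
have : coprimep (red x) (red f).
  rewrite coprimep_sym irreducible_poly_coprime //.
  by apply/negP => /dvdp_leq; rewrite x_neq0 leqNgt x_small => /(_ isT).
case/Bezout_eq1_coprimepP => -[u v] /= e.
have [u' eu] := red_surj u; have [v' ev] := red_surj v.
have [g eg] : exists g, u' * x + v' * f - 1 = p%:R * g.
  by apply: red_eq0; rewrite rmorphB rmorphD !rmorphM rmorph1 /= eu ev e subrr.
left; exists (in_qpoly f u' * (1 - p%:R * in_qpoly f g)).
have p20 : p%:R ^+ 2 = 0 :> R.
  by apply/eqP; rewrite -natrX natr_qpoly_eq0 ?p_sqr_gt1.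
have ux : in_qpoly f u' * x = 1 + p%:R * in_qpoly f g.
  rewrite -(rmorph_nat (in_qpoly f)) -rmorphM -eg !(rmorphB, rmorphD, rmorphM).
  by rewrite rmorph1 /= in_qpoly_modulus in_qpoly_val mulr0 addr0 addrC subrK.
by rewrite mulrAC ux; ring: p20.
Qed.

Lemma card_galois_ring : #|R| = ((p ^ r) ^ 2)%N.
Proof.
case: f_gal => f_mon sz _; rewrite card_monic_qpoly ?sz // card_ord.
by rewrite Zp_cast ?p_sqr_gt1 // expnAC.
Qed.

End GaloisRing.

Theorem proposition4p7 (p r : nat) (f : {poly 'Z_(p ^ 2)}) (xi : {poly %/ f})
    (p_prime : prime p) (p_odd : odd p) (r_gt0 : (0 < r)%N)
    (f_gal : galois_ring_poly r f) (xi_gen : teich_generator p r xi) :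
  let TS := teich_squares p r xi in
  let TN := teich_nonsquares p r xi in
  let n := (p ^ r - 1)%N in
  [/\ (n = 0 %[mod 4] ->
         [/\ -1 \in TS, TS = opp_set TS & double_set TS \subset Delta TS])
      /\ (n = 2 %[mod 4] ->
         [/\ -1 \in TN, TS = opp_set TN & double_set TS \subset diffs TS TN]),
      (n = 0 %[mod 12] ->
         1 \in Delta TS /\ TS \subset Delta TS)
      /\ (n = 6 %[mod 12] ->
         1 \in diffs TN TS /\ TS \subset diffs TN TS)
    & (n = 0 %[mod 8] \/ n = 6 %[mod 8] ->
         ring_square (2%:R : {poly %/ f})
         /\ square_coset p r xi (double_set TS))
      /\ (n = 2 %[mod 8] \/ n = 4 %[mod 8] ->
         ~ ring_square (2%:R : {poly %/ f})
         /\ nonsquare_coset p r xi (double_set TS))].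
Proof.
apply: (@teich_squares_cosets_and_differences {poly %/ f}) => //.
- rewrite natr_qpoly_eq0 ?p_sqr_gt1 //.
  by have := dvdn_Pexp2l 2 1 (prime_gt1 p_prime); rewrite expn1 => ->.
- by apply/eqP; rewrite -natrX natr_qpoly_eq0 ?p_sqr_gt1.
- exact: galois_ring_local f_gal.
- exact: card_galois_ring f_gal.
Qed.
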